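(* Assume the axiom of analytic determinacy. Let $\mathcal{I}$ be an analytic family of subsets of $\omega$. Then $\mathcal{I}^\perp$, ordered by inclusion, is Tukey equivalent to one of $\{0\}$, $\omega$, $\omega^\omega$, $\mathcal{K}(\mathbb{Q})$ or $[\mathfrak{c}]^{<\omega}$.
   Context: Subsets of $\omega=\{0,1,2,\dots\}$ are identified with their characteristic functions, so a family of subsets of $\omega$ is viewed as a subset of the Cantor set $2^\omega$ and it is called analytic if it is analytic as a subset of $2^\omega$. The orthogonal of $\mathcal{I}$ is $\mathcal{I}^\perp=\{a\subseteq\omega: a\cap b \text{ is finite for every } b\in\mathcal{I}\}$. The posets are: $\{0\}$ a singleton; $\omega$ with its natural order; $\omega^\omega$ with the pointwise order; $\mathcal{K}(\mathbb{Q})$, the compact subsets of the rationals, ordered by inclusion; $[\mathfrak{c}]^{<\omega}$, the finite subsets of the continuum $\mathfrak{c}$, ordered by inclusion. For partially ordered sets $P,Q$, a function $f:P\to Q$ is a Tukey function if for every $q_0\in Q$ there is $p_0\in P$ such that, for every $p\in P$, $f(p)\le q_0$ implies $p\le p_0$. Write $P\preceq Q$ if there is a Tukey function $P\to Q$. $P$ and $Q$ are Tukey equivalent if $P\preceq Q$ and $Q\preceq P$. The axiom of analytic determinacy states that every two-player infinite game of perfect information on $\omega$ with analytic payoff set is determined (one of the players has a winning strategy). *)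

(* Defs.v *)
From HB Require Import structures.
From mathcomp Require Import all_boot all_order all_algebra.
From mathcomp Require Import all_classical all_reals all_analysis.

Set Implicit Arguments.
Unset Strict Implicit.
Unset Printing Implicit Defensive.

Import numFieldNormedType.Exports.

Local Open Scope order_scope.
Local Open Scope classical_set_scope.

(* Subtypes carry the induced order; in particular, for [A : set (set X)],
   [set_type A] is ordered by inclusion. *)
HB.instance Definition _ d (T : porderType d) (P : pred T) :=
  [SubChoice_isSubPOrder of {x : T | P x} by <: with d].

Definition tukey_function d d' (P : porderType d) (Q : porderType d')
    (f : P -> Q) : Prop :=
  forall q0 : Q, exists p0 : P, forall p : P, f p <= q0 -> p <= p0.

Definition tukey_le d d' (P : porderType d) (Q : porderType d') : Prop :=
  exists f : P -> Q, tukey_function f.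

Definition tukey_equiv d d' (P : porderType d) (Q : porderType d') : Prop :=
  tukey_le P Q /\ tukey_le Q P.

Definition baire_space : Type := prod_topology (fun _ : nat => nat).

HB.instance Definition _ := Topological.on baire_space.

(* Intended for Polish [X]. *)
Definition analytic (X : topologicalType) (A : set X) : Prop :=
  A = set0 \/ exists f : baire_space -> X, continuous f /\ range f = A.

Definition charfun (a : set nat) : cantor_space := fun n => n \in a.

Definition analytic_family (I : set (set nat)) : Prop :=
  analytic (charfun @` I).

Definition orth_family (I : set (set nat)) : set (set nat) :=
  [set a | forall b, I b -> finite_set (a `&` b)].

(* [rat^o] carries the topology of the distance `|x - y|. *)
Definition compact_rationals : set (set rat) :=
  [set K | compact (K : set rat^o)].

(* The continuum is represented by the set of functions from nat to bool. *)
Definition finite_subsets_continuum : set (set (nat -> bool)) :=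
  [set F | finite_set F].

(* Players I and II alternately choose x 0, x 1, x 2, ..., with I playing at
   even and II at odd positions; I wins the run x iff A x.  A strategy maps the
   finite sequence of all previous moves to the next move. *)
Definition strategy : Type := seq nat -> nat.

Definition consistentI (s : strategy) (x : baire_space) : Prop :=
  forall n, x n.*2 = s (mkseq x n.*2).

Definition consistentII (s : strategy) (x : baire_space) : Prop :=
  forall n, x n.*2.+1 = s (mkseq x n.*2.+1).

Definition determined (A : set baire_space) : Prop :=
  (exists s, forall x, consistentI s x -> A x) \/
  (exists s, forall x, consistentII s x -> ~ A x).

Definition analytic_determinacy : Prop :=
  forall A : set baire_space, analytic A -> determined A.

(* Main.v *)
(** Write J for the orthogonal of I. In a game, Builder plays increasing integers
    and Separator puts each of them in a set A or in a set B; Builder wins when A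
    lies in an element of I, for which Builder also plays digits of a code, and B
    is in J. By analytic determinacy one of the players has a winning strategy.

    A winning strategy of Builder yields a perfect Luzin-type gap, hence continuum
    many elements of J of which no infinite subfamily is bounded, so that J is
    equivalent to the finite subsets of the continuum.

    A winning strategy of Separator yields countably many sets that separate the
    elements of I from those of J. They map the integers to the Cantor set, and
    then b is in J exactly when its accumulation points avoid the analytic set F
    of accumulation points of elements of I. If F is covered by countably many
    closed sets disjoint from E, the complement of F, then J is below the Baire
    order; if not, a Hurewicz scheme embeds the well-founded trees, which are
    equivalent to the compact sets of rationals and always bound J from above.
    Local compactness decides between omega and the Baire order. *)
Require Import Defs.
From mathcomp Require Import all_boot all_order all_algebra.
From mathcomp Require Import all_classical all_reals all_analysis.
From mathcomp Require Import zify ring lra.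

Set Implicit Arguments.
Unset Strict Implicit.
Unset Printing Implicit Defensive.

Local Open Scope classical_set_scope.

(** * Tukey reductions between families of sets *)

Lemma tukey_le_trans d1 d2 d3 (P : porderType d1) (Q : porderType d2)
    (R : porderType d3) :
  tukey_le P Q -> tukey_le Q R -> tukey_le P R.
Proof.
move=> [f hf] [g hg]; exists (g \o f) => r.
have [q hq] := hg r; have [p hp] := hf q.
by exists p => x hx; apply/hp/hq.
Qed.

Lemma tukey_le_family_to d (X : Type) (A : set (set X)) (Q : porderType d)
    (f : set X -> Q) :
  (forall q, exists2 p0, A p0 &
     forall p, A p -> (f p <= q)%O -> p `<=` p0) ->
  tukey_le (set_type A) Q.
Proof.
move=> h; exists (fun p => f (val p)) => q; have [p0 Ap0 hp0] := h q.
exists (SigSub (mem_set Ap0)) => p hp.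
rewrite -Order.le_val subsetEset.
by apply: hp0 => //; exact: set_mem (valP p).
Qed.

Lemma tukey_le_to_family d (P : porderType d) (Y : Type) (B : set (set Y))
    (f : P -> set Y) :
  (forall p, B (f p)) ->
  (forall q, B q -> exists p0, forall p, f p `<=` q -> (p <= p0)%O) ->
  tukey_le P (set_type B).
Proof.
move=> hB h; exists (fun p => SigSub (mem_set (hB p))) => q.
have [p0 hp0] := h _ (set_mem (valP q)); exists p0 => p.
by rewrite -Order.le_val subsetEset; exact: hp0.
Qed.

Lemma tukey_le_families (X Y : Type) (A : set (set X)) (B : set (set Y))
    (f : set X -> set Y) :
  (forall p, A p -> B (f p)) ->
  (forall q, B q -> exists2 p0, A p0 &
     forall p, A p -> f p `<=` q -> p `<=` p0) ->
  tukey_le (set_type A) (set_type B).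
Proof.
move=> hB h.
apply: (@tukey_le_to_family _ _ _ _ (fun p => f (val p))) => [p|q Bq].
  exact/hB/(set_mem (valP p)).
have [p0 Ap0 hp0] := h _ Bq; exists (SigSub (mem_set Ap0)) => p hp.
rewrite -Order.le_val subsetEset.
by apply: hp0 => //; exact: set_mem (valP p).
Qed.

Lemma tukey_equiv_trivial (X : Type) (A : set (set X)) :
  A setT -> tukey_equiv (set_type A) 'I_1.
Proof.
move=> AT; split.
  by apply: (@tukey_le_family_to _ _ _ _ (fun=> ord0)) => q; exists setT.
apply: (@tukey_le_to_family _ _ _ _ (fun=> setT)) => // q _.
by exists ord0 => p _; rewrite (ord1 p).
Qed.

(** * Branches of trees, agreement of sequences, bounded sets of integers *)

Lemma tree_branch (T : Type) (P : seq T -> Prop) :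
  P [::] -> (forall u, P u -> exists a, P (rcons u a)) ->
  exists x, forall k, P (mkseq x k).
Proof.
move=> P0 PS; have [a0 _] := PS _ P0.
have /choice [g hg] : forall u, exists a, P u -> P (rcons u a).
  move=> u; have [/PS [a ha]|nPu] := pselect (P u); first by exists a.
  by exists a0.
pose pre k := iter k (fun u => rcons u (g u)) [::].
have preE k : mkseq (fun i => g (pre i)) k = pre k.
  by elim: k => // k IH; rewrite mkseqS IH.
by exists (fun i => g (pre i)) => k; rewrite preE; elim: k => //= k; exact: hg.
Qed.

Lemma koenig (P : seq bool -> Prop) :
  P [::] -> (forall u, P u -> P (rcons u false) \/ P (rcons u true)) ->
  exists x, forall k, P (mkseq x k).
Proof.
by move=> P0 PS; apply: tree_branch => // u /PS[] h; [exists false|exists true].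
Qed.

Definition agree (T : Type) k (x y : nat -> T) := forall i, i < k -> x i = y i.

Lemma agree_sym (T : Type) k (x y : nat -> T) : agree k x y -> agree k y x.
Proof. by move=> h i ik; rewrite h. Qed.

Lemma agree_trans (T : Type) k (x y z : nat -> T) :
  agree k x y -> agree k y z -> agree k x z.
Proof. by move=> h h' i ik; rewrite h ?h'. Qed.

Lemma agreeW (T : Type) j k (x y : nat -> T) :
  j <= k -> agree k x y -> agree j x y.
Proof. by move=> jk h i ij; apply/h/(leq_trans ij). Qed.

Lemma mkseq_agree (T : Type) k (x y : nat -> T) :
  mkseq x k = mkseq y k <-> agree k x y.
Proof.
split=> [h i ik|h].
  by rewrite -(nth_mkseq (x i) x ik) h nth_mkseq.
apply: (@eq_from_nth _ (x 0)); rewrite ?size_mkseq // => i ik.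
by rewrite !nth_mkseq ?h.
Qed.

Definition nat_bounded (A : set nat) := exists k, forall n, A n -> n < k.

Lemma finite_nat_bounded A : finite_set A <-> nat_bounded A.
Proof.
split=> [/finite_seqP [s ->]|[k hk]].
  by exists (\max_(i <- s) i).+1 => n /= ns; rewrite ltnS leq_bigmax_seq.
by apply: (@sub_finite_set _ _ `I_k) => //; exact: finite_II.
Qed.

Lemma nat_boundedPn A : ~ nat_bounded A <-> forall k, exists2 n, k <= n & A n.
Proof.
split=> [h k|h [k hk]]; last by have [n kn /hk] := h k; lia.
apply: contrapT => h'; apply: h; exists k => n An.
by rewrite ltnNge; apply/negP => kn; apply: h'; exists n.
Qed.

Lemma nat_boundedS (A B : set nat) : A `<=` B -> nat_bounded B -> nat_bounded A.
Proof. by move=> AB [k hk]; exists k => n /AB/hk. Qed.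

Lemma nat_boundedU (A B : set nat) :
  nat_bounded A -> nat_bounded B -> nat_bounded (A `|` B).
Proof.
by move=> [j hj] [k hk]; exists (maxn j k) => n [/hj|/hk]; lia.
Qed.

Lemma nat_bounded_bigU (A : nat -> set nat) k :
  (forall i, i < k -> nat_bounded (A i)) ->
  nat_bounded [set n | exists2 i, i < k & A i n].
Proof.
elim: k => [_|k IH h]; first by exists 0 => n [].
have /IH h1 : forall i, i < k -> nat_bounded (A i).
  by move=> i ik; apply: h; lia.
apply: nat_boundedS (nat_boundedU h1 (h k _)) => // n [i ik Ain].
by case: (ltngtP i k) => [||e]; [left; exists i| lia| right; rewrite -e].
Qed.

(** * Accumulation points in the Cantor set *)

Section Accumulation.
Variable phi : nat -> nat -> bool.

(** The indices [n] accumulate, not the values [phi n]: a point that [phi] takes at infinitely many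
    elements of [A] counts. *)
Definition acc_point (A : set nat) (x : nat -> bool) :=
  forall k, exists n, [/\ k <= n, A n & agree k (phi n) x].

Lemma acc_point_exists A : ~ nat_bounded A -> exists x, acc_point A x.
Proof.
move=> Ainf.
pose c u := [set n | A n /\ mkseq (phi n) (size u) = u].
have [|u|x hx] := @koenig (fun u => ~ nat_bounded (c u)).
- by apply: contra_not Ainf => -[k hk]; exists k => n An; apply: hk.
- move=> hu; apply: contrapT => /not_orP[/contrapT h0 /contrapT h1].
  apply/hu/(nat_boundedS _ (nat_boundedU h0 h1)) => n [An un].
  by case e: (phi n (size u)); [right|left]; split;
    rewrite // size_rcons mkseqS un e.
- exists x => k; have [n kn [An]] := (nat_boundedPn _).1 (hx k) k.
  by rewrite size_mkseq => /mkseq_agree; exists n.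
Qed.

Lemma acc_point_sequence A x : acc_point A x ->
  exists l : nat -> nat, (forall k, l k < l k.+1) /\
    forall k, [/\ A (l k), k <= l k & agree k (phi (l k)) x].
Proof.
move=> /choice [g hg].
pose l := fix l k := if k is k'.+1 then g (maxn k (l k').+1) else g 0.
exists l; split=> [k|[|k]] /=.
- by have [+ _ _] := hg (maxn k.+1 (l k).+1); lia.
- by have [] := hg 0.
- have [h1 h2 h3] := hg (maxn k.+1 (l k).+1); split=> //; first by lia.
  by apply: agreeW h3; lia.
Qed.

End Accumulation.

(** * Well-founded trees *)

Definition wf_trees (T : Type) : set (set (seq T)) :=
  [set S | (forall u v, S (u ++ v) -> S u) /\
           forall x, exists k, ~ S (mkseq x k)].

Lemma wf_trees_countable (T : countType) :
  tukey_le (set_type (@wf_trees T)) (set_type (@wf_trees nat)).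
Proof.
apply: (@tukey_le_families _ _ _ _ (fun S => map pickle @` S)).
  move=> S [Spre Swf]; split=> [u v [w Sw]|x].
    move=> /(congr1 (take (size u))); rewrite take_size_cat // -map_take => <-.
    by exists (take (size u) w) => //; apply: (Spre _ (drop (size u) w));
      rewrite cat_take_drop.
  apply: contrapT => /forallNP/(_ _)/contrapT h.
  have /choice [y hy] : forall i, exists a : T, pickle a = x i.
    move=> i; have [w _ e] := h i.+1.
    have iw : i < size w by rewrite -(size_map pickle) e size_mkseq.
    case: w iw e => // a w iw e; exists (nth a (a :: w) i).
    by rewrite -(nth_map a 0) // e nth_mkseq.
  have [k] := Swf y; have [u Su e] := h k; apply.
  suff -> : mkseq y k = u by [].
  apply: (inj_map (pcan_inj (@pickleK T))).
  by rewrite e -map_comp; apply: eq_map => i /=; rewrite hy.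
move=> S [Spre Swf]; exists [set u | S (map pickle u)].
  split=> [u v|x]; first by rewrite /= map_cat; exact: Spre.
  have [k hk] := Swf (pickle \o x); exists k.
  by rewrite /= /mkseq -map_comp.
by move=> p _ pS u pu; apply: pS; exists u.
Qed.

Lemma take_mkseq_cat (T : Type) (z : nat -> T) u v :
  mkseq z (size (u ++ v)) = u ++ v -> mkseq z (size u) = u.
Proof.
move=> /(congr1 (take (size u))); rewrite take_size_cat // => {2}<-.
rewrite /mkseq -map_take take_iota size_cat; congr (map _ (iota _ _)); lia.
Qed.

Lemma take_mkseq (T : Type) (z : nat -> T) j k :
  j <= k -> take j (mkseq z k) = mkseq z j.
Proof.
by move=> jk; rewrite /mkseq -map_take take_iota; congr (map _ (iota _ _)); lia.
Qed.

(** * Orthogonals separated by countably many sets *)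

Section Separated.
(* [phi] codes countably many sets [{n | phi n i}] that separate, up to a finite
   set, each [f y] from each set orthogonal to it; through [phi], sets of
   integers acquire accumulation points in the Cantor set. *)
Variables (f : (nat -> nat) -> set nat) (phi : nat -> nat -> bool).
Variable J : set (set nat).
Hypothesis f_local : forall y n, exists k, forall y', agree k y y' ->
  (f y n <-> f y' n).
Hypothesis orthP : forall b, J b <-> forall y, nat_bounded (f y `&` b).
Hypothesis orth_separated : forall y b, J b -> exists i N, forall n, N <= n ->
  (b n -> phi n i) /\ (f y n -> ~~ phi n i).

(** This is the set E of the overview. *)
Definition off_acc x := forall y, ~ acc_point phi (f y) x.
Definition digits (z : nat -> nat * nat) k := (z k).1.
Definition label (z : nat -> nat * nat) k := (z k).2.

(* Along a branch the digits code some [f y], and the labels are an infinite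
   subset of it that converges to [x]. *)
Definition branch (z : nat -> nat * nat) x :=
  [/\ forall k, label z k < label z k.+1, forall k, f (digits z) (label z k) &
      forall k, agree k (phi (label z k)) x].

Lemma orthS a b : a `<=` b -> J b -> J a.
Proof.
move=> ab /orthP Jb; apply/orthP => y.
by apply: nat_boundedS (Jb y) => n [? /ab].
Qed.

Lemma orth_bounded a : nat_bounded a -> J a.
Proof. by move=> afin; apply/orthP => y; apply: nat_boundedS afin => n []. Qed.

(** Beyond [N], coordinate [i] of [phi] is true on [b] and false on [f y], so both sets cannot
    accumulate at the same point. *)
Lemma acc_point_orth b x : J b -> acc_point phi b x -> off_acc x.
Proof.
move=> Jb bx y yx; have [i [N h]] := orth_separated y Jb.
have [n [kn bn nx]] := bx (maxn i.+1 N).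
have [m [km ym mx]] := yx (maxn i.+1 N).
have [|/(_ bn) + _] := h n; first by lia.
have [|_ /(_ ym)] := h m; first by lia.
by rewrite mx ?nx ?leq_maxl // => /negP.
Qed.

Lemma label_ge z x k : branch z x -> k <= label z k.
Proof. by move=> [h _ _]; elim: k => // k IH; have := h k; lia. Qed.

Lemma branch_not_off z x : branch z x -> ~ off_acc x.
Proof.
move=> bz; apply/existsNP; exists (digits z) => nE; apply: nE => k.
by exists (label z k); split; [exact: label_ge bz| |]; case: bz.
Qed.

Lemma not_orth_branch b : ~ J b -> exists z x,
  branch z x /\ forall k, b (label z k).
Proof.
move=> nJ; have /existsNP [y /(@acc_point_exists phi) [x]] :
  ~ forall y, nat_bounded (f y `&` b) by move/orthP.
move=> /acc_point_sequence [l [l1 l2]]; exists (fun k => (y k, l k)), x.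
by split=> [|k]; first (split=> // k); have [[]] := l2 k.
Qed.

(** All conditions on a branch are closed, membership in [f] by [f_local], so the branches are the
    infinite paths of a tree. *)
Lemma branch_closed z :
  (forall k, exists z' x', branch z' x' /\ agree k z z') ->
  exists x, branch z x.
Proof.
move=> h; exists (fun i => phi (label z i.+1) i); split=> k.
- have [z' [x' [[+ _ _] zz']]] := h k.+2.
  by move=> /(_ k); rewrite /label !zz'.
- have [m hm] := f_local (digits z) (label z k).
  have [z' [x' [[_ + _] zz']]] := h (maxn k.+1 m).
  move=> /(_ k); have -> : label z' k = label z k by rewrite /label zz' //; lia.
  by apply: (hm _ _).2 => i im; rewrite /digits zz' //; lia.
- move=> i ik; have [z' [x' [[_ _ h'] zz']]] := h k.+1.
  have := h' k i ik; have := h' i.+1 i (ltnSn i).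
  by rewrite /label -!zz' // => -> ->.
Qed.

Lemma branch_agree z x z' x' k :
  branch z x -> branch z' x' -> agree k.+1 z z' -> agree k x x'.
Proof.
move=> [_ _ h] [_ _ h'] zz' i ik.
by rewrite -(h k i ik) -(h' k i ik) /label zz'.
Qed.

(** The tree [g b] searches for a branch whose limit is an accumulation point of [b]; an infinite
    path would contradict [acc_point_orth]. *)
Lemma orth_le_wf : tukey_le (set_type J) (set_type (@wf_trees (nat * nat))).
Proof.
pose g (b : set nat) := [set u | exists z x,
  [/\ branch z x, mkseq z (size u) = u &
      exists n, [/\ size u <= n, b n & agree (size u) (phi n) x]]].
apply: (@tukey_le_families _ _ _ _ g).
- move=> b Jb; split=> [u v [z [x [bz zu [n [un bn nx]]]]]|z].
    rewrite size_cat in un nx.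
    exists z, x; split=> //; first exact: take_mkseq_cat zu.
    by exists n; split=> //; [lia | apply: agreeW nx; lia].
  apply: contrapT => /forallNP/(_ _)/contrapT h.
  have {}h k : exists z' x', [/\ branch z' x', agree k z z' &
      exists n, [/\ k <= n, b n & agree k (phi n) x']].
    have [z' [x' [bz zu n]]] := h k; rewrite size_mkseq in zu n.
    by exists z', x'; split=> //; apply/mkseq_agree; rewrite zu.
  have [|x bz] := @branch_closed z.
    by move=> k; have [z' [x' []]] := h k; exists z', x'.
  apply: (branch_not_off bz); apply: (acc_point_orth Jb) => k.
  have [z' [x' [bz' zz' [n [kn bn nx]]]]] := h k.+1.
  exists n; split=> //; first by lia.
  apply: agree_trans (agree_sym (branch_agree bz bz' zz')).
  exact: agreeW nx.
(* The bound consists of the [n] that are close only to branches still inside [S]. If it were not in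
   [J], some branch would have all its labels in it and never leave [S]. *)
- move=> S [_ Swf]; exists [set n | forall z x k, branch z x ->
    k <= n -> agree k (phi n) x -> S (mkseq z k)].
    apply: contrapT => /not_orth_branch [z [x [bz hz]]].
    have [k] := Swf z; apply; apply: (hz k _ x) => //; first exact: label_ge bz.
    by case: bz.
  move=> b Jb gbS n bn z x k bz kn nx; apply: gbS.
  by exists z, x; rewrite size_mkseq; split=> //; exists n.
Qed.

Definition closed_family_off (C : set (nat -> bool))
    (F : nat -> set (nat -> bool)) :=
  (forall j x, (forall k, exists2 y, F j y & agree k y x) -> F j x) /\
  (forall j x, F j x -> C x -> False).

Definition covered u := exists2 F, closed_family_off off_acc F &
  forall z x, branch z x -> mkseq z (size u) = u -> exists j, F j x.

(** Accumulation points of [b] avoid each closed set [F j], so by compactness [b] keeps away from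
    [F j] from some stage on; [g b] sends [j] to that stage. *)
Lemma covered_le_baire : covered [::] -> tukey_le (set_type J) (nat -> nat).
Proof.
move=> [F [Fcl FE] Fz].
pose P b j k := forall n y,
  k <= n -> b n -> F j y -> agree k (phi n) y -> False.
have hP b j : exists k, J b -> P b j k.
  have [Jb|nJb] := pselect (J b); last by exists 0.
  apply: contrapT => nP.
  have h k : exists n y, [/\ k <= n, b n, F j y & agree k (phi n) y].
    apply: contrapT => h'; apply: nP; exists k => _ n y kn bn Fy ny.
    by apply: h'; exists n, y.
  (* Failures at every stage are localized in shrinking cells; their common point lies in [F j] and
     is an accumulation point of [b]. *)
  have [|u hu|x hx] := @koenig (fun u => forall k, exists n y,
    [/\ k <= n, b n, F j y & agree k (phi n) y /\ mkseq (phi n) (size u) = u]).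
  - by move=> k; have [n [y []]] := h k; exists n, y.
  - apply: contrapT => /not_orP[/existsNP[k0 h0] /existsNP[k1 h1]].
    have [n [y [kn bn Fy [ny nu]]]] := hu (maxn k0 k1).
    case e: (phi n (size u)); [apply: h1|apply: h0]; exists n, y;
      rewrite size_rcons mkseqS nu e; split=> //; try lia; split=> //;
      by apply: agreeW ny; lia.
  - apply: (FE j x).
      apply: Fcl => k; have [n [y [kn bn Fy [ny nu]]]] := hx k k.
      exists y => //; rewrite size_mkseq in nu.
      by apply: agree_trans (agree_sym ny) _; apply/mkseq_agree.
    apply: (acc_point_orth Jb) => k; have [n [y [kn bn _ [_]]]] := hx k k.
    by rewrite size_mkseq => /mkseq_agree nu; exists n.
have /choice [g hg] : forall b, exists g, J b -> forall j, P b j (g j).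
  move=> b; have /choice [g hg] := hP b; by exists g => Jb j; apply: hg.
apply: (@tukey_le_family_to _ _ _ _ g) => q.
exists [set n | forall j y,
  q j <= n -> F j y -> agree (q j) (phi n) y -> False].
  apply: contrapT => /not_orth_branch [z [x [bz hz]]].
  have [j Fx] := Fz _ _ bz (erefl _).
  by apply: (hz (q j) j x) => //; [exact: label_ge bz | case: bz].
move=> b Jb /lefP le n bn j y qn Fy ny.
apply: (hg b Jb j n y) => //; have := le j; rewrite leEnat.
  by lia.
by move=> gq; apply: agreeW ny.
Qed.

(* Hurewicz-type derivative: otherwise the closure of the limits of the branches
   through [u] with no covered node, together with the countably many families
   of the covered nodes, would cover [u]. *)
Lemma not_covered_limit u : ~ covered u -> exists2 p, off_acc p &
  forall k, exists z x, [/\ branch z x, mkseq z (size u) = u, agree k x p &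
    forall j, ~ covered (mkseq z j)].
Proof.
apply: contra_notP => nlim.
have /choice [G hG] : forall v, exists F, covered v ->
    closed_family_off off_acc F /\
    forall z x, branch z x -> mkseq z (size v) = v -> exists j, F j x.
  move=> v; have [[F ? ?]|ngv] := pselect (covered v); first by exists F.
  by exists (fun=> set0).
pose C := [set p | forall k, exists z x,
  [/\ branch z x, mkseq z (size u) = u, agree k x p &
    forall j, ~ covered (mkseq z j)]].
exists (fun n => match unpickle n with
  | Some (Some (v, j)) => [set x | covered v /\ G v j x]
  | Some None => C | None => set0 end).
  split=> [n x|n x].
    case: unpickle => [[[v j]|]|] h; last by have [] := h 0.
      have [? [gv _] _] := h 0; split=> //; have [[cl _] _] := hG v gv.
      by apply: cl => k; have [y [_ ?] ?] := h k; exists y.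
    move=> k; have [y /(_ k)[z [x' [bz zu x'y zb]]] yx] := h k.
    exists z, x'; split=> //.
    exact: agree_trans x'y yx.
  case: unpickle => [[[v j] [gv Gx] Ex|Cx Ex]|//].
    by have [[_ h] _] := hG v gv; apply: h Gx Ex.
  by apply: nlim; exists x.
move=> z x bz zu.
have [[k gk]|nk] := pselect (exists k, covered (mkseq z k)).
  have [_ /(_ z x bz)] := hG _ gk; rewrite size_mkseq => /(_ erefl) [j Gj].
  by exists (pickle (Some (mkseq z k, j))); rewrite pickleK.
exists (pickle (@None (seq (nat * nat) * nat))); rewrite pickleK => k.
by exists z, x; split=> // j gj; apply: nk; exists j.
Qed.

(** Hurewicz scheme: each uncovered node [u] has a point [p u] in [off_acc] and uncovered extensions
    [t u n] whose limits tend to [p u]. Iterating [t] indexes nodes by finite sequences, and a tree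
    [S] is sent to the set of last labels [m s] of its nodes. *)
Lemma not_covered_wf_le :
  ~ covered [::] -> tukey_le (set_type (@wf_trees nat)) (set_type J).
Proof.
move=> nc0.
have /choice [p hp] : forall u, exists p, ~ covered u -> off_acc p /\
    forall k, exists z x, [/\ branch z x, mkseq z (size u) = u, agree k x p &
    forall j, ~ covered (mkseq z j)].
  move=> u; have [gu|/not_covered_limit [p]] := pselect (covered u).
    by exists xpredT.
  by exists p.
have /choice [t0 ht0] : forall un : seq (nat * nat) * nat, exists t,
    ~ covered un.1 -> [/\ ~ covered t, exists v, t = un.1 ++ v, un.2 < size t,
      size un.1 < size t &
      forall z x, branch z x -> mkseq z (size t) = t -> agree un.2 x (p un.1)].
  move=> [u n] /=.
  have [gu|/hp [_ /(_ n) [z [x [bz zu xp zb]]]]] := pselect (covered u).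
    by exists [::].
  (* The successor pays for the entry lost in [branch_agree] and makes the length exceed both
     [size u] and [n]. *)
  exists (mkseq z (maxn (size u) n).+1) => _; rewrite size_mkseq; split=> //.
  - exists (drop (size u) (mkseq z (maxn (size u) n).+1)).
    by rewrite -{1}(cat_take_drop (size u) (mkseq z _)) take_mkseq ?zu //; lia.
  - by lia.
  - by lia.
  - move=> z' x' bz' /mkseq_agree zz'; apply: agree_trans xp.
    by apply: branch_agree bz' bz _; apply: agreeW zz'; lia.
pose t u n := t0 (u, n).
have ht u n : ~ covered u -> [/\ ~ covered (t u n), exists v, t u n = u ++ v,
    n < size (t u n), size u < size (t u n) &
    forall z x, branch z x -> mkseq z (size (t u n)) = t u n ->
      agree n x (p u)].
  exact: ht0 (u, n).
pose tau s := foldl t [::] s.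
have tauR s n : tau (rcons s n) = t (tau s) n by rewrite /tau foldl_rcons.
have tau_bad s : ~ covered (tau s).
  by elim/last_ind: s => // s n IH; rewrite tauR; have [] := ht (tau s) n IH.
have tau_cat s w : exists v, tau (s ++ w) = tau s ++ v.
  elim/last_ind: w => [|w n [v hv]]; first by exists [::]; rewrite !cats0.
  rewrite -rcons_cat tauR; have [_ [v' ->] _ _ _] := ht _ n (tau_bad (s ++ w)).
  by rewrite hv -catA; exists (v ++ v').
have tau_size s : size s <= size (tau s).
  elim/last_ind: s => // s n IH; rewrite tauR size_rcons.
  by have [_ _ _ + _] := ht _ n (tau_bad s); lia.
pose m s := (last (0, 0) (tau s)).2.
have m_label s z : s != [::] -> mkseq z (size (tau s)) = tau s ->
    m s = label z (size (tau s)).-1.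
  move=> s0 zs; have s1 : 0 < size (tau s).
    by rewrite (leq_trans _ (tau_size s)) // lt0n size_eq0.
  rewrite /m /label (last_nth (0, 0)) -{1}zs.
  case e : (size (tau s)) s1 => [//|k] _ /=.
  by rewrite -[nth _ _ k]/(nth (0,0) ((0,0) :: mkseq z k.+1) k.+1) /= nth_mkseq.
(* The estimate is uniform in [w]: all labels below child [n] of [s] tend to [p (tau s)] as [n]
   grows. *)
have m_near s n w : n <= m (rcons s n ++ w) /\
    agree n (phi (m (rcons s n ++ w))) (p (tau s)).
  have [v hv] := tau_cat (rcons s n) w.
  have [_ /(_ 0) [z [x [bz zu _ _]]]] := hp _ (tau_bad (rcons s n ++ w)).
  have [_ _ ns _ near] := ht _ n (tau_bad s).
  rewrite (m_label _ z) //; last by case: (s).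
  have tn : n <= (size (tau (rcons s n ++ w))).-1.
    by rewrite hv tauR size_cat; lia.
  split; first by apply: leq_trans tn _; exact: label_ge bz.
  apply: (@agree_trans _ _ _ x); last first.
    apply: near bz _; rewrite -tauR; apply: (@take_mkseq_cat _ _ _ v).
    by rewrite -hv.
  by have [_ _ h] := bz; apply: agreeW (h _).
pose g (S : set (seq nat)) := [set m s | s in [set s | S s /\ s != [::]]].
apply: (@tukey_le_families _ _ _ _ g).
  move=> S [Spre Swf]; apply/orthP => y; apply: contrapT => yinf.
  pose D s := f y `&`
    [set n | exists w, [/\ S (s ++ w), s ++ w != [::] & n = m (s ++ w)]].
  (* Since [p (tau s)] is not an accumulation point of [f y], only finitely many children of [s]
     contribute to [D s], and one of them contributes infinitely much. This descent never leaves
     [S]. *)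
  have [||x hx] := @tree_branch _ (fun s => ~ nat_bounded (D s)).
  - move=> Dfin; apply: yinf; apply: nat_boundedS Dfin => n [yn [s [Ss s0] e]].
    rewrite -e in yn *.
    by split=> //=; exists s.
  - move=> s Dinf; apply: contrapT => /forallNP/(_ _)/contrapT Dfin.
    have [Ep _] := hp _ (tau_bad s).
    have /existsNP [k hk] := Ep y.
    apply: Dinf; apply: nat_boundedS (nat_boundedU
      (_ : nat_bounded [set m s])
      (@nat_bounded_bigU (fun n => D (rcons s n)) k _)) => //.
    + move=> n' [yn [[|n w] [Ssw sw0 e]]]; rewrite e in yn *.
        by left; rewrite cats0.
      right; exists n; last first.
        by split=> //=; exists w; rewrite cat_rcons.
      rewrite ltnNge; apply/negP => kn; apply: hk; exists (m (s ++ n :: w)).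
      have [nm near] := m_near s n w; rewrite cat_rcons in nm near.
      by split=> //; [lia| apply: agreeW near].
    + by exists (m s).+1 => n ->.
  - have [k] := Swf x; apply.
    have [n _ [_ [w [Sw _ _]]]] := (nat_boundedPn _).1 (hx k) 0.
    exact: Spre Sw.
move=> b Jb.
exists [set s | forall r w, s = r ++ w -> r != [::] -> b (m r)]; last first.
  move=> S [Spre _] Sb s Ss r w e r0; apply: Sb; exists r => //; split=> //.
  by apply: (Spre _ w); rewrite -e.
split=> [u v h r w e|x]; first by apply: (h r (w ++ v)); rewrite e catA.
apply: contrapT => /forallNP/(_ _)/contrapT hx.
(* An infinite path [x] makes the nodes [tau] converge to a branch [z], and infinitely many labels
   of [z] lie in [b], against [b] being in [J]. *)
pose z i := nth (0, 0) (tau (mkseq x i.+1)) i.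
have tau_nth j k i : j <= k -> i < size (tau (mkseq x j)) ->
    nth (0, 0) (tau (mkseq x k)) i = nth (0, 0) (tau (mkseq x j)) i.
  move=> jk ij; have [v] := tau_cat (mkseq x j) (drop j (mkseq x k)).
  by rewrite -{1}(take_mkseq x jk) cat_take_drop => ->; rewrite nth_cat ij.
have zE k : mkseq z (size (tau (mkseq x k))) = tau (mkseq x k).
  apply: (@eq_from_nth _ (0, 0)); rewrite size_mkseq // => i ik.
  rewrite nth_mkseq // /z; case: (leqP k i.+1) => ki.
    exact: tau_nth.
  apply/esym/tau_nth; first by lia.
  by have := tau_size (mkseq x i.+1); rewrite size_mkseq.
have [|x' bz] := @branch_closed z.
  move=> k.
  have [_ /(_ 0) [z' [x' [bz' zu _ _]]]] := hp _ (tau_bad (mkseq x k)).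
  exists z', x'; split=> //; rewrite -{2}(zE k) in zu.
  move/mkseq_agree: zu => /agree_sym.
  by apply: agreeW; have := tau_size (mkseq x k); rewrite size_mkseq.
have [k hk] := (orthP b).1 Jb (digits z).
have mk : m (mkseq x k.+1) = label z (size (tau (mkseq x k.+1))).-1.
  by apply: m_label => //; rewrite -size_eq0 size_mkseq.
have := hk (m (mkseq x k.+1)); rewrite ltnNge => /(_ _)/negP; apply.
  split; last by apply: (hx k.+1 _ [::]); rewrite ?cats0 // -size_eq0 size_mkseq.
  by rewrite mk; case: bz.
rewrite mk; apply: leq_trans (label_ge _ bz).
by have := tau_size (mkseq x k.+1); rewrite size_mkseq; lia.
Qed.

Let c u := [set n | mkseq (phi n) (size u) = u].

(** The sets [d k] join the first [k] integers and the cells in [J] among the first [k] codes.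
    Either they are cofinal in [J], or some [x] in [off_acc] has no cell around it in [J]. *)
Lemma omega_or_baire_le :
  tukey_le (set_type J) nat \/ tukey_le (nat -> nat) (set_type J).
Proof.
pose d k := [set n | n < k \/ exists u, [/\ pickle u < k, J (c u) & c u n]].
have Jd k : J (d k).
  apply/orthP => y; pose A i :=
    [set n | f y n /\ exists u, [/\ pickle u = i, J (c u) & c u n]].
  apply: nat_boundedS (nat_boundedU (_ : nat_bounded `I_k)
    (@nat_bounded_bigU A k _)); last first.
  - move=> i _; have [[u [<- Ju]]|nu] :=
        pselect (exists u : seq bool, pickle u = i /\ J (c u)).
      apply: nat_boundedS ((orthP _).1 Ju y) => n [yn [v [+ _ cn]]].
      by move=> /(pcan_inj (@pickleK _)) e; split; rewrite -?e.
    by exists 0 => n [_ [u [ui Ju _]]]; case: nu; exists u.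
  - by exists k.
  - move=> n [yn [nk|[u [uk Ju un]]]]; [by left | right].
    by exists (pickle u) => //; split=> //; exists u.
have dS j k : j <= k -> d j `<=` d k.
  move=> jk n [nj|[u [uj Ju un]]]; first by left; lia.
  by right; exists u; split=> //; lia.
have [cof|/existsNP [b /not_implyP [Jb nb]]] :=
    pselect (forall b, J b -> exists k, b `<=` d k).
  left; have /choice [g hg] : forall b, exists k, J b -> b `<=` d k.
    by move=> b; have [/cof [k bk]|nJ] := pselect (J b); [exists k|exists 0].
  apply: (@tukey_le_family_to _ _ _ _ g) => q; exists (d q) => // b Jb gq.
  by move=> n /(hg b Jb); exact: dS.
right.
have [||x hx] := @koenig (fun u => forall k, ~ b `&` c u `<=` d k).
- by move=> k bd; apply: nb; exists k => n bn; apply: bd.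
- move=> u hu; apply: contrapT => /not_orP[].
  move=> /existsNP[k0 /contrapT h0] /existsNP[k1 /contrapT h1].
  apply: (hu (maxn k0 k1)) => n [bn nu].
  by case e : (phi n (size u));
    [apply: (dS k1); [lia|apply: h1]|apply: (dS k0); [lia|apply: h0]];
    split=> //; rewrite /c /= size_rcons mkseqS nu e.
have Ex : off_acc x.
  apply: (acc_point_orth Jb) => k.
  have /existsNP[n /not_implyP[[bn]]] := hx k k.
  rewrite /c /= size_mkseq => /mkseq_agree nx ndk; exists n; split=> //.
  by rewrite leqNgt; apply/negP => nk; apply: ndk; left.
(* A cell around [x] that was in [J] would be contained in some [d k]. *)
have /choice [y hy] : forall k, exists y, ~ nat_bounded (f y `&` c (mkseq x k)).
  move=> k; apply/existsNP => h.
  apply: (hx k (pickle (mkseq x k)).+1) => n [_ nk].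
  by right; exists (mkseq x k); split=> //; apply/orthP.
pose a k := f (y k) `&` c (mkseq x k).
(* The image of [h] is in [J] since it can accumulate only at [x]. A set [q] in [J] omits a point of
   every [a k], and these points bound [h]. *)
apply: (@tukey_le_to_family _ _ _ _
  (fun h => [set n | exists2 k, a k n & n <= h k])).
  move=> h; apply/orthP => y'; have /existsNP [k hk] := Ex y'.
  have kfin : nat_bounded [set n | exists2 i, i < k & n <= h i].
    apply: (@nat_bounded_bigU (fun i => [set n | n <= h i])) => i _.
    by exists (h i).+1.
  apply: nat_boundedS (nat_boundedU (_ : nat_bounded `I_k) kfin); last by exists k.
  move=> n [yn [i [_ ni] nh]]; case: (ltnP n k) => [|kn]; [by left|right].
  exists i => //; rewrite ltnNge; apply/negP => ki; apply: hk.
  exists n; split=> //.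
  by rewrite /c /= size_mkseq in ni; move/mkseq_agree: ni; exact: agreeW.
move=> q Jq.
have /choice [h hh] : forall k, exists n, a k n /\ ~ q n.
  move=> k; have [M hM] := (orthP q).1 Jq (y k).
  have [n Mn an] := (nat_boundedPn _).1 (hy k) M; exists n; split=> // qn.
  by have := hM n (conj an.1 qn); lia.
exists h => p pq; apply/lefP => k; rewrite leEnat leqNgt; apply/negP => hp.
by have [ak] := hh k; apply; apply: pq; exists k => //; lia.
Qed.

Lemma omega_le_orth : ~ J setT -> tukey_le nat (set_type J).
Proof.
move=> nJT; apply: (@tukey_le_to_family _ _ _ _ (fun k => `I_k)).
  by move=> k; apply: orth_bounded; exists k.
move=> q Jq; have [n nq] : exists n, ~ q n.
  by apply/existsNP => qT; apply: nJT; apply: orthS Jq => n _; apply: qT.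
exists n => k kq; rewrite leEnat leqNgt; apply/negP => nk; apply: nq; exact: kq.
Qed.

End Separated.

(** * Compact sets of rationals and well-founded trees *)

Section RationalTrees.
Import Order.TTheory GRing.Theory Num.Theory.
Import numFieldNormedType.Exports.
Local Open Scope ring_scope.

Lemma rat_nbhsP (x : rat) (B : set rat) :
  nbhs (x : rat^o) B <-> exists2 e : rat, 0 < e & forall y, `|x - y| < e -> B y.
Proof.
rewrite -(@nbhs_nbhs_norm rat rat^o); split=> [[e e0 h]|[e e0 h]];
  exists e => // y; exact: h.
Qed.

Lemma rat_invSn_lt (e : rat) : 0 < e -> exists n : nat, n.+1%:R^-1 < e.
Proof.
move=> e0; have [N _ hN] := @near_infty_natSinv_lt rat (PosNum e0).
by exists N; apply: hN => /=.
Qed.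

Lemma compact_rationals_fip (K : set rat) (C : nat -> set rat) :
  compact_rationals K ->
  (forall i p, ~ C i p -> exists2 e : rat, 0 < e &
     forall y, `|p - y| < e -> ~ C i y) ->
  (forall k, exists2 p, K p & forall i, (i < k)%N -> C i p) ->
  exists2 p, K p & forall i, C i p.
Proof.
move=> Kc Ccl fip.
pose B k := [set p | K p /\ forall i, (i < k)%N -> C i p].
have PF : ProperFilter (filter_from [set: nat] B).
  apply: filter_from_proper; last first.
    by move=> k _; have [p Kp pC] := fip k; exists p.
  apply: filter_from_filter; first by exists 0%N.
  move=> j k _ _; exists (maxn j k) => // p [Kp h].
  by split; split=> // i ij; apply: h; rewrite leq_max ij ?orbT.
have [|p [Kp pcl]] := Kc (filter_from setT B) PF.
  by exists 0%N => // p [].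
exists p => // i; apply: contrapT => /Ccl [e e0 he].
have [||y [[_ yC] ye]] := pcl (B i.+1) [set y | `|p - y| < e].
- by exists i.+1.
- by apply/rat_nbhsP; exists e.
- by apply: (he y ye); apply: yC.
Qed.

Local Definition ratn (i : nat) : rat := odflt 0 (unpickle i).

Local Lemma ratnP (p : rat) : ratn (pickle p) = p.
Proof. by rewrite /ratn pickleK. Qed.

(* A node [u] stands for the points at distance at least [1 / (u_i + 1)] from the
   [i]-th rational for all [i]; along an infinite branch no rational is left. *)
Lemma compact_rationals_le_wf :
  tukey_le (set_type compact_rationals) (set_type (@wf_trees nat)).
Proof.
pose g (K : set rat) := [set u : seq nat | exists2 p, K p &
  forall i, (i < size u)%N -> (nth 0%N u i).+1%:R^-1 <= `|p - ratn i|].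
apply: (@tukey_le_families _ _ _ _ g).
  move=> K Kc; split=> [u v [p Kp h]|x].
    exists p => // i iu; have := h i; rewrite size_cat nth_cat iu; apply; lia.
  apply: contrapT => /forallNP/(_ _)/contrapT h.
  have [||p Kp] := @compact_rationals_fip K
      (fun i => [set p | (x i).+1%:R^-1 <= `|p - ratn i|]) Kc.
  - move=> i p /= /negP; rewrite -ltNge => hp.
    exists ((x i).+1%:R^-1 - `|p - ratn i|); first by rewrite subr_gt0.
    move=> y py; apply/negP; rewrite -ltNge.
    have -> : y - ratn i = (p - ratn i) - (p - y) by ring.
    by apply: le_lt_trans (ler_normB _ _) _; rewrite -ltrBrDl.
  - move=> k; have [p Kp hp] := h k; exists p => // i ik.
    by have := hp i; rewrite size_mkseq nth_mkseq //; apply.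
  - move=> /(_ (pickle p)) /=; rewrite ratnP subrr normr0 leNgt invr_gt0.
    by rewrite ltr0Sn.
move=> S [_ Swf].
(* The strict inequality makes [K0] closed; the weak one in [g] makes the constraints closed, as the
   intersection argument requires. *)
pose K0 := [set p : rat | forall u : seq nat,
  (forall i, (i < size u)%N -> (nth 0%N u i).+1%:R^-1 < `|p - ratn i|) -> S u].
exists K0; last first.
  move=> K Kc gKS p Kp u hu; apply: gKS; exists p => // i iu; exact/ltW/hu.
move=> F PF FK0; apply: contrapT => ncl.
(* The filter stays away from every rational: from those in [K0] because they are not cluster
   points, from the others because [K0] is closed. The bounds form a path that must leave [S]. *)
have far i : exists n : nat, F [set p | n.+1%:R^-1 < `|p - ratn i|].
  suff [A FA [e e0 Ae]] : exists2 A, F A &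
      exists2 e : rat, 0 < e & forall y, A y -> e <= `|ratn i - y|.
    have [n ne] := rat_invSn_lt e0; exists n; apply: filterS FA => y /Ae /=.
    by rewrite distrC; exact: lt_le_trans.
  have [K0i|/existsNP [u /not_implyP[hu nSu]]] := pselect (K0 (ratn i)).
    have /existsNP[A /existsNP[B]] : ~ cluster F (ratn i : rat^o).
      by move=> cl; apply: ncl; exists (ratn i).
    move=> /not_implyP[FA /not_implyP[/rat_nbhsP[e e0 eB] AB]].
    exists A => //; exists e => // y Ay; rewrite leNgt; apply/negP => /eB By.
    by apply: AB; exists y.
  have [e e0 he] : exists2 e : rat, 0 < e & forall y, `|ratn i - y| < e ->
      forall j, (j < size u)%N -> (nth 0%N u j).+1%:R^-1 < `|y - ratn j|.
    elim: (size u) hu => [_|k IH hk]; first by exists 1.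
    have [|e e0 he] := IH; first by move=> j jk; apply: hk; rewrite ltnS ltnW.
    pose e' := `|ratn i - ratn k| - (nth 0%N u k).+1%:R^-1.
    have e'0 : 0 < e' by rewrite subr_gt0 hk.
    exists (Num.min e e'); first by rewrite lt_min e0.
    move=> y; rewrite lt_min => /andP[ye ye'] j.
    rewrite ltnS leq_eqVlt => /predU1P[->|]; last exact: he.
    have : `|ratn i - ratn k| <= `|ratn i - y| + `|y - ratn k|.
      exact: ler_distD.
    by move: ye'; rewrite /e'; move: (_%:R^-1) => c; lra.
  exists K0 => //; exists e => // y K0y; rewrite leNgt; apply/negP => /he hy.
  by apply: nSu; apply: K0y.
have /choice [x hx] := far.
have [k] := Swf x; apply.
have Fk : F [set p | forall i, (i < k)%N -> (x i).+1%:R^-1 < `|p - ratn i|].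
  elim: k => [|k IH]; first by apply: filterS filterT.
  apply: filterS (filterI IH (hx k)) => p [h1 h2] i.
  by rewrite ltnS leq_eqVlt => /predU1P[->|/h1].
have [p [K0p hp]] := filter_ex (filterI FK0 Fk).
by apply: K0p => i; rewrite size_mkseq => ik; rewrite nth_mkseq //; apply: hp.
Qed.

(** One of [c + d] and [c - d] differs from [r]. Halving leaves [d] for moving the centre and [d]
    for the new radius. *)
Lemma shrinking_step (c rho r : rat) (n : nat) : 0 < rho ->
  exists c' rho' : rat, 0 < rho' /\ forall p, `|p - c'| <= rho' ->
    [/\ `|p - c| <= rho, `|p - c| <= n.+1%:R^-1 & p <> r].
Proof.
move=> rho0; pose d := Num.min rho n.+1%:R^-1 / 2.
have d0 : 0 < d by rewrite divr_gt0 // lt_min rho0 invr_gt0 ltr0Sn.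
have [drho dn] : 2 * d <= rho /\ 2 * d <= n.+1%:R^-1.
  by rewrite /d mulrCA mulfV // mulr1 !ge_min !lexx orbT.
have [c' c'd c'r] : exists2 c', `|c' - c| = d & c' != r.
  have [e|ne] := eqVneq (c + d) r; last first.
    by exists (c + d) => //; rewrite addrAC subrr add0r gtr0_norm.
  exists (c - d); first by rewrite addrAC subrr add0r normrN gtr0_norm.
  by rewrite -e; apply/eqP; lra.
exists c', (Num.min d (`|c' - r| / 2)).
have cr0 : 0 < `|c' - r| by rewrite normr_gt0 subr_eq0.
split=> [|p]; first by rewrite lt_min d0 divr_gt0.
rewrite le_min => /andP[pd pr].
have : `|p - c| <= `|p - c'| + `|c' - c| by exact: ler_distD.
rewrite c'd => h; move: dn; move: (n.+1%:R^-1) => q dn; split; [lra|lra|].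
by move=> e; move: pr; rewrite e distrC; lra.
Qed.

(** The children of [s] converge to the centre [e s], and each level excludes one more rational, so
    the balls along an infinite path have no common rational point. *)
Lemma shrinking_balls : exists (e : seq nat -> rat) (B : seq nat -> set rat),
  [/\ forall s, B s (e s),
      forall s w, B (s ++ w) `<=` B s,
      forall s n p, B (rcons s n) p -> `|e s - p| <= n.+1%:R^-1,
      forall s n p, B (rcons s n) p -> p <> ratn (size s) &
      forall s p, ~ B s p -> exists2 d : rat, 0 < d &
        forall y, `|p - y| < d -> ~ B s y].
Proof.
have /choice [g hg] : forall a : (rat * rat) * rat * nat, exists b : rat * rat,
    0 < a.1.1.2 -> 0 < b.2 /\ forall p, `|p - b.1| <= b.2 ->
    [/\ `|p - a.1.1.1| <= a.1.1.2, `|p - a.1.1.1| <= a.2.+1%:R^-1 & p <> a.1.2].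
  move=> [[[c rho] r] n] /=; have [rho0|_] := ltP 0 rho; last by exists (0, 0).
  by have [c' [rho' h]] := shrinking_step c r n rho0; exists (c', rho').
pose st := foldl (fun a n => (g (a.1, ratn a.2, n), a.2.+1)) ((0, 1), 0%N).
have stR s n : st (rcons s n) = (g ((st s).1, ratn (st s).2, n), (st s).2.+1).
  by rewrite /st foldl_rcons.
have st2 s : (st s).2 = size s.
  by elim/last_ind: s => // s n IH; rewrite stR size_rcons /= IH.
have st_gt0 s : 0 < (st s).1.2.
  elim/last_ind: s => // s n IH; rewrite stR /=.
  by have [] := hg ((st s).1, ratn (st s).2, n) IH.
pose B s := [set p | `|p - (st s).1.1| <= (st s).1.2].
have BR s n p : B (rcons s n) p -> [/\ B s p, `|p - (st s).1.1| <= n.+1%:R^-1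
    & p <> ratn (size s)].
  rewrite /B /= stR /= st2 => h.
  by have [_ /(_ p h)] := hg ((st s).1, ratn (size s), n) (st_gt0 s).
exists (fun s => (st s).1.1), B; split.
- by move=> s; rewrite /B /= subrr normr0 ltW.
- move=> s; elim/last_ind => [|w n IH] p; first by rewrite cats0.
  by rewrite -rcons_cat => /BR[/IH].
- by move=> s n p /BR[]; rewrite distrC.
- by move=> s n p /BR[].
- move=> s p /negP; rewrite -ltNge => hp.
  exists (`|p - (st s).1.1| - (st s).1.2); first by rewrite subr_gt0.
  move=> y py By; have : `|p - (st s).1.1| <= `|p - y| + `|y - (st s).1.1|.
    exact: ler_distD.
  by rewrite /B /= in By; lra.
Qed.

Lemma wf_le_compact_rationals :
  tukey_le (set_type (@wf_trees nat)) (set_type compact_rationals).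
Proof.
have [e [B [eB BS Bnear Bavoid Bcl]]] := shrinking_balls.
apply: (@tukey_le_families _ _ _ _ (fun S => e @` S)); last first.
  move=> K Kc; exists [set s | forall r w, s = r ++ w -> K (e r)]; last first.
    move=> S [Spre _] SK s Ss r w srw; apply: SK; exists r => //.
    by apply: (Spre _ w); rewrite -srw.
  split=> [u v h r w uE|x]; first by apply: (h r (w ++ v)); rewrite uE catA.
  apply: contrapT => /forallNP/(_ _)/contrapT h.
  have [||p Kp hp] := @compact_rationals_fip K (fun i => B (mkseq x i.+1)) Kc.
  - by move=> i p; exact: Bcl.
  - move=> k; exists (e (mkseq x k)).
      by apply: (h k _ [::]); rewrite cats0.
    move=> i ik; apply: (BS _ (drop i.+1 (mkseq x k))).
    by rewrite -(take_mkseq x ik) cat_take_drop.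
  - have := hp (pickle p); rewrite mkseqS => /Bavoid; rewrite size_mkseq ratnP.
    exact.
move=> S [Spre Swf] F PF FS; apply: contrapT => ncl.
pose D s := [set p | exists2 w, S (s ++ w) & p = e (s ++ w)].
pose pos (A : set rat) := forall B, F B -> A `&` B !=set0.
have posU A A' : pos (A `|` A') -> pos A \/ pos A'.
  move=> pAA'; apply: contrapT => /not_orP[/existsNP[C /not_implyP[FC nC]]].
  move=> /existsNP[C' /not_implyP[FC' nC']].
  have [p [[Ap|Ap] [Cp C'p]]] := pAA' _ (filterI FC FC').
    by apply: nC; exists p.
  by apply: nC'; exists p.
have [||x hx] := @tree_branch _ (fun s => pos (D s)).
- move=> C FC; have [p [[s Ss <-] Cp]] := filter_ex (filterI FS FC).
  by exists (e s); split=> //; exists s.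
- move=> s pD.
  have Ss : S s.
    by have [p [[w Sw _] _]] := pD setT filterT; exact: Spre Sw.
  have /existsNP[A /existsNP[C]] : ~ cluster F (e s : rat^o).
    by move=> cl; apply: ncl; exists (e s); split=> //; exists s.
  move=> /not_implyP[FA /not_implyP[/rat_nbhsP[d d0 dC] AC]].
  have [N Nd] := rat_invSn_lt d0.
  have AD p : A p -> d <= `|e s - p|.
    move=> Ap; rewrite leNgt; apply/negP => /dC Cp; apply: AC; by exists p.
  (* Points below child [n] are within [1 / (n + 1)] of [e s], while [A] keeps distance [d] from it,
     so only the children below [N] matter. *)
  have : pos [set p | exists2 n, (n < N)%N & D (rcons s n) p].
    move=> C' FC'; have [p [[w Sw pE] [Ap C'p]]] := pD _ (filterI FA FC').
    exists p; split=> //; case: w Sw pE => [|n w] Sw pE.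
      by have := AD p Ap; rewrite pE cats0 subrr normr0 leNgt d0.
    exists n; last by exists w; rewrite cat_rcons.
    rewrite ltnNge; apply/negP => Nn.
    have := AD p Ap; rewrite leNgt => /negP; apply.
    apply: le_lt_trans Nd; apply: (@le_trans _ _ n.+1%:R^-1).
      by apply: Bnear; apply: (BS _ w); rewrite pE -cat_rcons; exact: eB.
    by rewrite lef_pV2 ?posrE ?ltr0Sn // ler_nat.
  elim: N {Nd} => [|N IH] pN; first by have [p [[]]] := pN setT filterT.
  have [|/IH//|] :=
    @posU [set p | exists2 n, (n < N)%N & D (rcons s n) p] (D (rcons s N)).
    move=> C' /pN [p [[n nN Dp] C'p]]; exists p; split=> //.
    move: nN; rewrite ltnS leq_eqVlt => /predU1P[<-|nN]; first by right.
    by left; exists n.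
  by exists N.
- have [k] := Swf x; apply; have [p [[w Sw _] _]] := hx k setT filterT.
  exact: Spre Sw.
Qed.

End RationalTrees.

(** * Continuity on Baire space and projections of closed sets *)

Lemma baire_cylinder_nbhs (y : baire_space) k : nbhs y [set y' | agree k y y'].
Proof.
elim: k => [|k IH]; first by apply: filterS filterT.
have : nbhs y (proj k @^-1` [set y k]).
  by apply: (@proj_continuous nat (fun=> nat) k y); exact: discrete_set1.
move=> h; apply: filterS (filterI IH h) => y' [h1 h2] i.
by rewrite ltnS leq_eqVlt => /predU1P[->|/h1].
Qed.

Lemma baire_nbhsP (y : baire_space) (B : set baire_space) :
  nbhs y B -> exists k, forall y', agree k y y' -> B y'.
Proof.
pose G : set_system baire_space :=
  filter_from [set: nat] (fun k => [set y' | agree k y y']).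
have FG : Filter G.
  apply: filter_from_filter; first by exists 0.
  move=> j k _ _; exists (maxn j k) => // y' h.
  by split; apply: agreeW h; lia.
suff Gy : G --> y by move=> /Gy [k _ h]; exists k.
apply/(@pointwise_cvgP nat nat) => t; apply/discrete_cvg.
by exists t.+1 => // y' h; rewrite /= h.
Qed.

Lemma baire_continuous (g : baire_space -> baire_space) :
  (forall y n, exists k, forall y', agree k y y' -> g y n = g y' n) ->
  continuous g.
Proof.
move=> gloc y; apply/(@pointwise_cvgP nat nat) => t; apply/discrete_cvg.
have [k hk] := gloc y t; apply: filterS (baire_cylinder_nbhs y k) => y' /hk.
by move=> /= ->.
Qed.

Lemma cantor_continuousP (g : baire_space -> cantor_space) :
  continuous g ->
  forall y n, exists k, forall y', agree k y y' -> g y n = g y' n.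
Proof.
move=> gc y n; apply: (@baire_nbhsP y [set y' | g y n = g y' n]).
have h : nbhs (g y) (proj n @^-1` [set g y n]).
  by apply: (@proj_continuous nat (fun=> bool) n (g y)); exact: discrete_set1.
have {}h : nbhs (y : baire_space) (g @^-1` (proj n @^-1` [set g y n])).
  exact: gc y _ h.
by apply: filterS h => y' /= <-.
Qed.

Local Definition dec n : nat * nat := odflt (0, 0) (unpickle n).

Local Lemma decK p : dec (pickle p) = p.
Proof. by rewrite /dec pickleK. Qed.

(** The closed set [D] of sequences of pairs is a continuous retract of the space of all such
    sequences; the parametrization is the retraction [ret] followed by the first coordinate. *)
Lemma analytic_projection (C : (nat -> nat) -> (nat -> nat) -> Prop) :
  (forall x w, (forall k, exists x' w',
     [/\ C x' w', agree k x x' & agree k w w']) -> C x w) ->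
  analytic [set x : baire_space | exists w, C x w].
Proof.
move=> Ccl; have [[x0 [w0 C0]]|empty] := pselect (exists x w, C x w); last first.
  left; apply/seteqP; split=> // x [w Cxw]; apply: empty; by exists x, w.
right; pose D (z : nat -> nat * nat) := C (fst \o z) (snd \o z).
pose T u := exists2 z, D z & mkseq z (size u) = u.
have TS z j k : j <= k -> T (mkseq z k) -> T (mkseq z j).
  move=> jk [z' Dz']; rewrite size_mkseq => /mkseq_agree e; exists z' => //.
  by rewrite size_mkseq; apply/mkseq_agree/(agreeW jk).
have T0 z : T (mkseq z 0) by exists (fun i => (x0 i, w0 i)).
have /choice [beta hbeta] :
    forall u, exists z, T u -> D z /\ mkseq z (size u) = u.
  move=> u; have [[z Dz zu]|nT] := pselect (T u); first by exists z.
  by exists (fun i => (0, 0)).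
have betaE z k : T (mkseq z k) ->
    D (beta (mkseq z k)) /\ agree k (beta (mkseq z k)) z.
  by move=> /hbeta []; rewrite size_mkseq => ? /mkseq_agree.
(* [L z n] is the length of the longest prefix of [z], among those of length at most [n], that
   extends to a point of [D]; [ret] continues as the point chosen for that prefix. *)
pose L := fix L z n := if n is n'.+1 then
  (if `[< T (mkseq z n) >] then n else L z n') else 0.
pose ret z n := beta (mkseq z (L z n.+1)) n.
have LE z n : L z n <= n.
  by elim: n => //= n IH; case: ifP => // _; exact: leqW.
have L_agree n z z' : agree n z z' -> L z n = L z' n.
  elim: n => //= n IH zz'; rewrite (IH (agreeW _ zz')) //.
  by rewrite ((mkseq_agree _ _ _).2 zz').
have LT z n : T (mkseq z n) -> L z n = n.
  by case: n => //= n Tn; rewrite asboolT.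
have retT z : (forall k, T (mkseq z k)) -> ret z = z.
  move=> Tz; apply/funext => n; rewrite /ret LT //.
  by have [_ ->] := betaE z n.+1 (Tz _).
have Dret z : D (ret z).
  have [Tz|/existsNP nT] := pselect (forall k, T (mkseq z k)).
    apply: Ccl => k; have [Dz zz] := betaE z k (Tz k).
    rewrite retT //.
    exists (fst \o beta (mkseq z k)), (snd \o beta (mkseq z k)).
    by split=> // i ik /=; rewrite zz.
  have exP : exists k, ~~ `[< T (mkseq z k) >].
    by have [k hk] := nT; exists k; apply/asboolPn.
  case: (ex_minnP exP) => [[|K]] /asboolPn nTK Kmin; first by have := T0 z.
  have TK : T (mkseq z K).
    by apply: contrapT => /asboolPn/Kmin; rewrite ltnn.
  suff -> : ret z = beta (mkseq z K) by have [] := betaE z K TK.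
  apply/funext => n; rewrite /ret; case: (ltnP n K) => nK.
    have TSn : T (mkseq z n.+1) by apply: TS TK.
    rewrite LT //; have [_ ->] := betaE z _ TSn => //.
    by have [_ ->] := betaE z _ TK.
  suff -> : L z n.+1 = K by [].
  have Lk m : K <= m -> L z m = K.
    elim: m => [|m IH] Km; first by move: Km; rewrite leqn0 => /eqP ->.
    case: (ltngtP K m.+1) Km => // [Km _|<- _]; last exact: LT.
    rewrite /= asboolF ?IH // => Tm; apply: nTK; exact: TS Tm.
  by apply: Lk; lia.
exists (fun y : baire_space => (fst \o ret (dec \o y) : baire_space)); split.
  apply: baire_continuous => y n; exists n.+1 => y' yy'.
  have e : agree n.+1 (dec \o y) (dec \o y') by move=> i ik /=; rewrite yy'.
  rewrite /= /ret (L_agree _ _ _ e); congr (beta _ n).1.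
  by apply/mkseq_agree/(agreeW (LE _ _) e).
apply/seteqP; split=> [_ [y _ <-]|x [w Cxw]].
  by exists (snd \o ret (dec \o y)); exact: Dret.
exists (fun i => pickle (x i, w i)) => //.
have -> : dec \o (fun i => pickle (x i, w i)) = (fun i => (x i, w i)).
  by apply/funext => i /=; rewrite decK.
rewrite retT // => k; exists (fun i => (x i, w i)) => //.
by rewrite size_mkseq.
Qed.

(** * The separation game *)

Section Game.
(* Round [k]: Builder (player II) plays a code of an integer and a digit at
   position [2k+1], Separator (player I) answers at position [2k+2]; the move of
   Separator at position [0] is ignored. Builder must play increasing integers,
   with those answered by a nonzero number lying in [f] of the digits and the
   others forming a set in [J]. *)
Variables (f : (nat -> nat) -> set nat) (J : set (set nat)).
Hypothesis f_local : forall y n, exists k, forall y', agree k y y' ->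
  (f y n <-> f y' n).
Hypothesis orthP : forall b, J b <-> forall y, nat_bounded (f y `&` b).

Let move_int (x : nat -> nat) k := (dec (x k.*2.+1)).1.
Let move_digits (x : nat -> nat) k := (dec (x k.*2.+1)).2.
Let answer (x : nat -> nat) k := x k.*2.+2.
Let small_side x := [set n | exists2 k, answer x k = 0 & n = move_int x k].

Let foul x k := ~ move_int x k < move_int x k.+1 \/
  (answer x k != 0 /\ ~ f (move_digits x) (move_int x k)).

Definition separator_wins : set baire_space :=
  [set x | (exists k, foul x k) \/
    exists y, ~ nat_bounded (f y `&` small_side x)].

Lemma separator_wins_analytic : analytic separator_wins.
Proof.
(* In the witness [w], the entry [w 0] is [k + 1] for a foul at [k] and 0 otherwise. In the latter
   case odd entries spell [y], and later even ones name rounds showing that [f y] meets the small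
   side infinitely often. *)
pose C (x w : nat -> nat) := if w 0 is k.+1 then foul x k else
  forall i, [/\ answer x (w i.*2.+2) = 0, i <= move_int x (w i.*2.+2) &
                f (fun j => w j.*2.+1) (move_int x (w i.*2.+2))].
suff -> : separator_wins = [set x : baire_space | exists w, C x w].
  apply: analytic_projection => x w h; rewrite /C.
  case e : (w 0) => [|k].
    move=> i.
    have [m hm] := f_local (fun j => w j.*2.+1) (move_int x (w i.*2.+2)).
    pose M := (i.*2.+3 + (w i.*2.+2).*2.+3 + m.*2.+2).
    have [x' [w' [+ xx' ww']]] := h M.
    rewrite /C -ww' ?e; last by rewrite /M; lia.
    move=> /(_ i); rewrite -ww'; last by rewrite /M; lia.
    rewrite /answer /move_int -!xx'; try by rewrite /M; lia.
    move=> [-> -> hf]; split=> //.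
    by apply: (hm _ _).2 hf => j jm; apply: ww'; rewrite /M; lia.
  have [m hm] := f_local (move_digits x) (move_int x k).
  have [x' [w' [+ xx' ww']]] := h (k.*2.+4 + m.*2.+2).
  rewrite /C -ww' ?e; last by lia.
  have e1 : move_int x' k = move_int x k by rewrite /move_int xx' //; lia.
  have e2 : move_int x' k.+1 = move_int x k.+1 by rewrite /move_int xx' //; lia.
  have e3 : answer x' k = answer x k by rewrite /answer xx' //; lia.
  rewrite /foul e1 e2 e3 => -[?|[? nf]]; [by left|right; split=> //].
  apply: contra_not nf; apply: (hm _ _).1 => j jm.
  by rewrite /move_digits xx' //; lia.
apply/seteqP; split=> x.
  move=> [[k fk]|[y /nat_boundedPn yinf]]; first by exists (fun=> k.+1).
  have /choice [g hg] : forall i, exists k,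
      [/\ answer x k = 0, i <= move_int x k & f y (move_int x k)].
    by move=> i; have [n ni [yn [k ? nk]]] := yinf i; exists k; rewrite -nk.
  exists (fun n => if n is n'.+1 then
    if odd n' then g n'./2 else y n'./2 else 0).
  rewrite /C => i /=; rewrite odd_double /=.
  have -> : (fun j => if odd j.*2 then g j.*2./2 else y j.*2./2) = y.
    by apply/funext => j; rewrite odd_double doubleK.
  by rewrite uphalf_double; exact: hg.
move=> [w]; rewrite /C; case e: (w 0) => [|k] h; last by left; exists k.
right; exists (fun j => w j.*2.+1); apply/nat_boundedPn => k.
have [h1 h2 h3] := h k; exists (move_int x (w k.*2.+2)) => //; split=> //.
by exists (w k.*2.+2).
Qed.

Lemma exists_run (T : Type) (sigma : seq T -> T) :
  exists x : nat -> T, forall n, x n = sigma (mkseq x n).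
Proof.
have [|u hu|x hx] := @tree_branch T (fun u =>
  forall v a w, u = rcons v a ++ w -> a = sigma v).
- by move=> [|b v] a w.
- exists (sigma u) => v a w; elim/last_ind: w => [|w c _].
    by rewrite cats0 => /rcons_inj [-> ->].
  by rewrite -rcons_cat => /rcons_inj [/hu].
- by exists x => n; apply: (hx n.+1 _ _ [::]); rewrite cats0 mkseqS.
Qed.

Lemma run_agree (T : Type) (sigma sigma' : seq T -> T) x x' n :
  (forall i, x i = sigma (mkseq x i)) ->
  (forall i, x' i = sigma' (mkseq x' i)) ->
  (forall u, size u < n -> sigma u = sigma' u) -> agree n x x'.
Proof.
move=> hx hx'; elim: n => [//|n IH] h.
have xx' : agree n x x' by apply: IH => u un; apply: h; lia.
move=> i; rewrite ltnS leq_eqVlt => /predU1P[->|/xx' //].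
by rewrite hx hx' ((mkseq_agree n x x').2 xx') h ?size_mkseq.
Qed.

(** A separating set is given by a position [p] and a digit [j]: it contains the [n] to which [s]
    answers nonzero after [p] when Builder plays [(n, j)]. If none separated [f y] from [b], Builder
    could always continue with the digits of [y] and beat [s]. *)
Lemma separator_strategy s : (forall x, consistentI s x -> separator_wins x) ->
  exists phi : nat -> nat -> bool, forall y b, J b ->
    exists i N, forall n, N <= n -> (b n -> phi n i) /\ (f y n -> ~~ phi n i).
Proof.
move=> swin.
exists (fun n i =>
  if unpickle i : option (seq nat * nat) is Some (p, j)
  then s (rcons p (pickle (n, j))) != 0 else false).
move=> y b Jb; apply: contrapT => nsep.
have /choice [R hR] : forall X : nat -> nat, exists x : nat -> nat, forall n,
    x n = if odd n then pickle (X n./2, y n./2) else s (mkseq x n).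
  move=> X; have [x hx] := exists_run (fun u =>
    if odd (size u) then pickle (X (size u)./2, y (size u)./2) else s u).
  by exists x => n; rewrite hx size_mkseq.
have R_agree k X X' : agree k X X' -> agree k.*2.+1 (R X) (R X').
  move=> XX'; apply: (run_agree (sigma := fun u =>
    if odd (size u) then pickle (X (size u)./2, y (size u)./2) else s u)
    (sigma' := fun u =>
    if odd (size u) then pickle (X' (size u)./2, y (size u)./2) else s u)).
  - by move=> i; rewrite size_mkseq; exact: hR.
  - by move=> i; rewrite size_mkseq; exact: hR.
  - by move=> u uk; case: ifP => // uodd; rewrite XX' //; lia.
have R_even X k : R X k.*2 = s (mkseq (R X) k.*2) by rewrite hR odd_double.
have R_odd X k : R X k.*2.+1 = pickle (X k, y k).
  by rewrite hR /= odd_double /= uphalf_double.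
(* Along legal moves the integers answered by 0 lie in [b] and the others in [f y], so Separator
   loses. *)
pose legal (X : nat -> nat) k :=
  (forall j, j < k -> if R X j.*2.+2 != 0 then f y (X j) else b (X j)) /\
  (forall j, j.+1 < k -> X j < X j.+1).
have legal_agree X X' k : agree k X X' -> legal X k -> legal X' k.
  move=> XX' [h1 h2]; split=> j jk; last first.
    by rewrite -(XX' j.+1) // -(XX' j); [exact: h2|lia].
  by rewrite -(R_agree _ _ _ XX' j.*2.+2) -?(XX' j) //; [exact: h1|lia].
have [||X hX] := @tree_branch nat (fun u => legal (nth 0 u) (size u)).
- by split.
- move=> u [h1 h2].
  pose p := mkseq (R (nth 0 u)) (size u).*2.+1.
  have [n [nu hn]] : exists n, last 0 u < n /\
      ((b n /\ s (rcons p (pickle (n, y (size u)))) = 0) \/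
       (f y n /\ s (rcons p (pickle (n, y (size u)))) != 0)).
    apply: contrapT => h; apply: nsep.
    exists (pickle (p, y (size u))), (last 0 u).+1 => n nu.
    rewrite pickleK; split=> [bn|fn]; last first.
      by apply/negP => sn; apply: h; exists n; split=> //; right.
    by apply/negP => /eqP sn; apply: h; exists n; split=> //; left.
  exists n; rewrite size_rcons.
  have uu : agree (size u) (nth 0 u) (nth 0 (rcons u n)).
    by move=> j ju; rewrite nth_rcons ju.
  have [h1' h2'] := legal_agree _ _ _ uu (conj h1 h2).
  split=> j; rewrite ltnS leq_eqVlt => /predU1P[|]; last first.
  + exact: h2'.
  + move=> ju; rewrite !nth_rcons -ju ltnSn ltnn eqxx.
    by move: nu; rewrite (last_nth 0) -ju.
  + exact: h1'.
  + move=> ->; rewrite -doubleS R_even doubleS mkseqS R_odd nth_rcons ltnn eqxx.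
    rewrite -((mkseq_agree _ _ _).2 (R_agree _ _ _ uu)) -/p.
    by case: hn => -[? sn]; rewrite sn ?eqxx.
have {}hX k : legal X k.
  have := hX k; rewrite size_mkseq; apply: legal_agree => j jk.
  exact: nth_mkseq.
have mE k : move_int (R X) k = X k by rewrite /move_int R_odd decK.
have dE : move_digits (R X) = y.
  by apply/funext => k; rewrite /move_digits R_odd decK.
have [|[k [|[k0 +]]]|[w]] := swin (R X).
- by move=> k; rewrite R_even.
- by rewrite !mE; apply; have [_] := hX k.+2; exact.
- rewrite dE mE; apply; have [/(_ k (ltnSn k)) + _] := hX k.+1.
  by move: k0; rewrite /answer => ->.
- apply; apply: nat_boundedS ((orthP b).1 Jb w) => n [wn [k k0 nk]]; split=> //.
  rewrite nk mE; have [/(_ k (ltnSn k)) + _] := hX k.+1.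
  by rewrite -/(answer (R X) k) k0 eqxx.
Qed.

(** Here [x] lists the answers of Separator, and [m x], [d x] are the integers and digits of
    Builder's reply; the integer of round [k] depends only on earlier answers. *)
Lemma finite_subsets_continuum_le (m : (nat -> bool) -> nat -> nat)
    (d : (nat -> bool) -> nat -> nat) :
  (forall (x y : nat -> bool) k, agree k x y -> m x k = m y k) ->
  (forall x k, m x k < m x k.+1) ->
  (forall (x : nat -> bool) k, x k -> f (d x) (m x k)) ->
  (forall x : nat -> bool, J [set n | exists2 k, ~~ x k & n = m x k]) ->
  tukey_le (set_type finite_subsets_continuum) (set_type J).
Proof.
move=> m_agree m_incr mf mJ.
have m_ge x k : k <= m x k by elim: k => // k IH; have := m_incr x k; lia.
pose b x := [set n | exists2 k, ~~ x k & n = m x k].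
(* A union of sets [b y] is unbounded in [J] when the [y] converge to some [x]
   from the left in the lexicographic order. Adding [b (neg x)] to [b x] lets the
   same argument apply to sequences converging from the right. *)
pose neg (x : nat -> bool) k := ~~ x k.
pose g F := [set n | exists2 x, F x & b x n \/ b (neg x) n].
apply: (@tukey_le_families _ _ _ _ g).
  move=> F /finite_seqP [s ->]; apply/orthP => y.
  elim: s => [|x s IH]; first by exists 0 => n [_ []].
  apply: nat_boundedS (nat_boundedU IH (nat_boundedU
    ((orthP _).1 (mJ x) y) ((orthP _).1 (mJ (neg x)) y))).
  move=> n [yn [z]]; rewrite /= inE => /predU1P[->|zs] hz.
    by case: hz => ?; right; [left|right].
  by left; split=> //; exists z.
move=> q Jq; exists [set x | b x `<=` q /\ b (neg x) `<=` q]; last first.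
  by move=> F _ Fq x Fx; split=> n xn; apply: Fq; exists x => //; [left|right].
rewrite /finite_subsets_continuum /=; set Q := [set x | _].
(* If [y] first leaves [x] at [i], with [y i] false and [x i] true, then [m x i] is in both
   [f (d x)] and [b y]. Arbitrarily late such [i] would make [q] meet [f (d x)] infinitely often. *)
have no_limit x : ~ forall k, exists i y,
    [/\ k <= i, b y `<=` q, agree i y x, ~~ y i & x i].
  move=> h; have [M hM] := (orthP q).1 Jq (d x).
  have [i [y [Mi yq yx yi xi]]] := h M.
  have : m x i < M.
    apply: hM; split; first exact: mf.
    by apply: yq; exists i => //; rewrite (m_agree y x).
  by have := m_ge x i; lia.
apply: contrapT => Qinf.
pose Qu u := [set y | Q y /\ mkseq y (size u) = u].
have [|u hu|x hx] := @koenig (fun u => ~ finite_set (Qu u)).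
- apply: contra_not Qinf; apply: sub_finite_set => y Qy; by split.
- apply: contrapT => /not_orP[/contrapT h0 /contrapT h1]; apply: hu.
  apply: (@sub_finite_set _ _ (Qu (rcons u false) `|` Qu (rcons u true)));
    last by rewrite finite_setU.
  move=> y [Qy yu]; case e: (y (size u)); [right|left]; split=> //;
    by rewrite size_rcons mkseqS yu e.
have {}hx k : exists i y, [/\ k <= i, Q y, agree i y x & y i != x i].
  have [y [[Qy yx] ynx]] : exists y, [set y | Q y /\ agree k y x] y /\ y <> x.
    apply: contrapT => h; apply: (hx k).
    apply: (@sub_finite_set _ _ [set x]) => //.
    move=> y [Qy]; rewrite size_mkseq => /mkseq_agree yx.
    by apply: contrapT => ynx; apply: h; exists y.
  have exP : exists i, y i != x i.
    apply: contrapT => h; apply: ynx; apply/funext => i; apply/eqP.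
    by apply: contrapT => /negP yxi; apply: h; exists i.
  case: (ex_minnP exP) => i yxi imin; exists i, y; split=> //.
    by rewrite leqNgt; apply/negP => ik; rewrite yx ?eqxx in yxi.
  move=> j ji; apply/eqP; by apply: contrapT => /negP/imin; rewrite leqNgt ji.
(* Either [x i] is true at arbitrarily late splitting points, or it is false at all late ones and
   [neg x] is a forbidden limit. *)
have [h|/existsNP [K hK]] := pselect (forall k, exists i y,
    [/\ k <= i, Q y, agree i y x, y i != x i & x i]).
  apply: (no_limit x) => k; have [i [y [ki [yq _] yx yxi xi]]] := h k.
  by exists i, y; split=> //; move: yxi; rewrite xi; case: (y i).
apply: (no_limit (neg x)) => k.
have [i [y [ki Qy yx yxi]]] := hx (maxn K k).
exists i, (neg y); split; first by lia.
- by case: Qy.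
- by move=> j ji; rewrite /neg yx.
- rewrite /neg negbK; case xi : (x i) yxi; last by case: (y i).
  by move=> yi; case: hK; exists i, y; split=> //; [lia|rewrite xi].
- by rewrite /neg; apply/negP => xi; apply: hK; exists i, y; split=> //; lia.
Qed.

Lemma builder_strategy s : (forall x, consistentII s x -> ~ separator_wins x) ->
  tukey_le (set_type finite_subsets_continuum) (set_type J).
Proof.
move=> swin.
(* Separator plays 0 at position 0 and the bit [y k] at position [2k + 2]. *)
pose sigma (y : nat -> bool) (u : seq nat) :=
  if odd (size u) then s u
  else if size u is k.+1 then nat_of_bool (y k./2) else 0.
have /choice [R hR] : forall y, exists x, forall n, x n = sigma y (mkseq x n).
  by move=> y; exact: exists_run.
have R_agree k y y' : agree k y y' -> agree k.*2.+2 (R y) (R y').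
  move=> yy'; apply: run_agree (hR y) (hR y') _ => u uk; rewrite /sigma.
  case: ifP => // uodd; case e: (size u) uk uodd => [//|n] uk uodd.
  by rewrite yy' //; lia.
have R_ans y k : answer (R y) k = y k.
  by rewrite /answer hR /sigma size_mkseq /= negbK odd_double /= uphalf_double.
have lost y : ~ separator_wins (R y).
  by apply: swin => n; rewrite /= [LHS]hR /sigma size_mkseq /= odd_double.
have nofoul y k : ~ foul (R y) k.
  by move=> h; apply: (lost y); left; exists k.
apply: (@finite_subsets_continuum_le
  (fun y => move_int (R y)) (fun y => move_digits (R y))).
- by move=> y y' k yy'; rewrite /move_int (R_agree _ _ _ yy') //.
- by move=> y k; apply: contrapT => h; apply: (nofoul y k); left.
- move=> y k yk; apply: contrapT => h; apply: (nofoul y k); right.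
  by rewrite R_ans yk.
- move=> y; apply/orthP => w; apply: contrapT => h; apply: (lost y).
  right; exists w.
  apply: contra_not h; apply: nat_boundedS => n [wn [k yk nk]]; split=> //.
  by exists k => //; rewrite R_ans; case: (y k) yk.
Qed.

(** Sets of integers inject into the continuum, and [J] is closed under finite unions: a finite set
    of codes is bounded by the union of the members of [J] that it codes. *)
Lemma orth_le_finite_subsets_continuum :
  tukey_le (set_type J) (set_type finite_subsets_continuum).
Proof.
pose chi (b : set nat) n := `[< b n >].
have chiK a b : chi a = chi b -> a `<=` b.
  move=> e n /asboolP an; apply/asboolP.
  by rewrite -[asbool _]/(chi b n) -e.
apply: (@tukey_le_families _ _ _ _ (fun b => [set chi b])).
  by move=> b _; exact: finite_set1.
move=> q /finite_seqP [s ->].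
exists [set n | exists b, [/\ J b, chi b \in s & b n]]; last first.
  by move=> b Jb bs n bn; exists b; split=> //; apply: (bs (chi b)).
apply/orthP => y; elim: s => [|x s IH]; first by exists 0 => n [_ [b []]].
have [[b [Jb xb]]|nx] := pselect (exists b, J b /\ chi b = x).
  apply: nat_boundedS (nat_boundedU IH ((orthP b).1 Jb y)).
  move=> n [yn [b' [Jb' + b'n]]].
  rewrite inE => /predU1P[e|b's]; last by left; split=> //; exists b'.
  by right; split=> //; apply: (chiK b') b'n; rewrite e.
apply: nat_boundedS IH => n [yn [b' [Jb' + b'n]]]; rewrite inE => /predU1P[e|b's].
  by case: nx; exists b'.
by split=> //; exists b'.
Qed.

Lemma orth_classification (AD : analytic_determinacy) :
  tukey_equiv (set_type J) 'I_1 \/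
  tukey_equiv (set_type J) nat \/
  tukey_equiv (set_type J) (nat -> nat) \/
  tukey_equiv (set_type J) (set_type compact_rationals) \/
  tukey_equiv (set_type J) (set_type finite_subsets_continuum).
Proof.
have [[s /separator_strategy [phi orth_separated]]|[s /builder_strategy h]] :=
    AD _ separator_wins_analytic; last first.
  by do 4 right; split=> //; exact: orth_le_finite_subsets_continuum.
have [JT|nJT] := pselect (J setT); first by left; exact: tukey_equiv_trivial.
right.
have [Jo|oJ] := omega_or_baire_le orthP orth_separated.
  by left; split=> //; exact: omega_le_orth.
right.
have [g|ng] := pselect (covered f phi [::]).
  left; split=> //; exact: (covered_le_baire orthP orth_separated g).
right; left; split.
  apply: tukey_le_trans (orth_le_wf f_local orthP orth_separated) _.
  apply: tukey_le_trans (wf_trees_countable _) wf_le_compact_rationals.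
apply: tukey_le_trans compact_rationals_le_wf _.
exact: (not_covered_wf_le f_local orthP) ng.
Qed.

End Game.

Theorem theoremB (AD : analytic_determinacy)
    (I : set (set nat)) (hI : analytic_family I) :
  tukey_equiv (set_type (orth_family I)) 'I_1 \/
  tukey_equiv (set_type (orth_family I)) nat \/
  tukey_equiv (set_type (orth_family I)) (nat -> nat) \/
  tukey_equiv (set_type (orth_family I)) (set_type compact_rationals) \/
  tukey_equiv (set_type (orth_family I)) (set_type finite_subsets_continuum).
Proof.
case: hI => [I0|[g [gc gI]]].
  (* The orthogonal of the empty family contains all sets of integers. *)
  left; apply: tukey_equiv_trivial => b Ib.
  by have : set0 (charfun b) by rewrite -I0; exists b.
apply: (@orth_classification (fun y => [set n | g y n])) => //.
  move=> y n; have [k hk] := cantor_continuousP gc y n; exists k => y' /hk /= ->.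
  by [].
move=> b; split=> [Jb y|h a Ia].
  have [a Ia ga] : (charfun @` I) (g y) by rewrite -gI; exists y.
  apply/finite_nat_bounded; rewrite setIC.
  suff -> : [set n | g y n] = a by exact: Jb.
  by rewrite -ga; apply/seteqP; split=> n; rewrite /charfun /= in_setE.
have [y _ gy] : range g (charfun a) by rewrite gI; exists a.
apply/finite_nat_bounded; rewrite setIC.
suff -> : a = [set n | g y n] by exact: h.
by rewrite gy; apply/seteqP; split=> n; rewrite /charfun /= in_setE.
Qed.
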